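(* Let $X$ be a real locally convex topological vector space and let $f,g\colon X\to(-\infty,\infty]$ be convex functions. Suppose that $f$ is polyhedral and that $\mathrm{dom}(f)\cap\mathrm{qri}(\mathrm{dom}(g))\neq\emptyset$. Then $$\inf\{f(x)+g(x)\mid x\in X\}=\sup\{-f^*(-x^* )-g^*(x^* )\mid x^*\in X^*\}.$$
   Context: $\mathrm{dom}(f):=\{x\in X\mid f(x)<\infty\}$ and $\mathrm{epi}(f):=\{(x,\lambda)\in X\times\mathbb{R}\mid f(x)\le\lambda\}$. The Fenchel conjugate is $f^*(x^* ):=\sup\{\langle x^*,x\rangle-f(x)\mid x\in X\}$, $x^*\in X^*$. A subset $P$ of a locally convex space $Z$ is a convex polyhedron if $P=\{z\in Z\mid\langle z_i^*,z\rangle\le\alpha_i,\ i=1,\dots,k\}$ for finitely many $z_i^*\in Z^*$, $\alpha_i\in\mathbb{R}$; $f$ is polyhedral if $\mathrm{epi}(f)$ is a convex polyhedron in $X\times\mathbb{R}$. For a convex set $\Omega$, $\mathrm{qri}(\Omega):=\{x\in\Omega\mid\overline{\mathrm{cone}(\Omega-x)}\text{ is a linear subspace}\}$, where $\mathrm{cone}(A):=\{ta\mid t\ge0,\ a\in A\}$. *)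

(* Defs.v *)
From HB Require Import structures.
From mathcomp Require Import all_boot all_order all_algebra.
From mathcomp Require Import all_classical all_reals all_analysis.

Set Implicit Arguments.
Unset Strict Implicit.
Unset Printing Implicit Defensive.

Import Order.TTheory GRing.Theory Num.Theory.
Import numFieldNormedType.Exports.

Local Open Scope classical_set_scope.
Local Open Scope ring_scope.

(* In MathComp-Analysis, [tvsType R] is the interface of locally convex
   topological vector spaces, not assumed to be Hausdorff, and the product
   of two of them carries the product topology. *)

Section convex_functions.
Context {R : realType} {X : tvsType R}.
Implicit Types f : X -> \bar R.

Definition edom f : set X := [set x | (f x < +oo)%E].

Definition epi f : set (X * R^o)%type := [set p | (f p.1 <= p.2%:E)%E].

(* For functions that never take the value -oo: the right-hand side is then
   never of the form +oo - oo. *)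
Definition convex_efun f : Prop :=
  forall (x y : X) (t : R), 0 < t < 1 ->
    (f (t *: x + (1 - t) *: y)%R <= t%:E * f x + (1 - t)%:E * f y)%E.

(* The elements of the topological dual are the linear forms in this set. *)
Definition top_dual : set {linear X -> R^o} :=
  [set u | continuous (u : X -> R^o)].

Definition fenchel_conj f (u : {linear X -> R^o}) : \bar R :=
  ereal_sup [set ((u x)%:E - f x)%E | x in [set: X]].

Definition cone (A : set X) : set X :=
  [set z | exists t : R, exists2 a, A a & 0 <= t /\ z = t *: a].

Definition qri (Omega : set X) : set X :=
  [set x | Omega x /\
     submod_closed (mem (closure (cone [set y - x | y in Omega])))].

End convex_functions.

Definition convex_polyhedron {R : realType} {Z : tvsType R} (P : set Z) : Prop :=
  exists (k : nat) (z : 'I_k -> {linear Z -> R^o}) (a : 'I_k -> R),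
    (forall i, top_dual (z i)) /\ P = [set x | forall i, z i x <= a i].

Definition polyhedral {R : realType} {X : tvsType R} (f : X -> \bar R) : Prop :=
  convex_polyhedron (epi f).

(* Main.v *)
Require Import Defs.
From HB Require Import structures.
From mathcomp Require Import all_boot all_order all_algebra.
From mathcomp Require Import all_classical all_reals all_analysis.
From mathcomp Require Import ring lra.

(** Fenchel duality between a polyhedral function and a convex function.

The inequality sup <= inf is the Fenchel-Young inequality applied to both
conjugates ([weak_duality]).  For the other one, the polyhedrality of f turns
the minimization of f + g into the minimization of the convex function
G (y, s) = g y + s over the pairs (y, s) with y in dom g, subject to the
finitely many continuous affine constraints z_i (y, s) <= a_i that describe
epi f.  If r is a finite lower bound of f + g, then G - r is nonnegative on the
feasible pairs, and Lagrange multipliers mu_i >= 0 give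

  g y + s - r + sum_i mu_i (z_i (y, s) - a_i) >= 0   for all y in dom g and s.

As s is free, sum_i mu_i z_i (0, 1) = -1, and u := - sum_i mu_i z_i (., 0) is a
continuous linear form with - f^*(-u) - g^*(u) >= r
([dual_attains_lower_bound]).

So everything rests on the existence of multipliers
([lagrange_multipliers]).  Only finitely many affine functions are involved,
and all that the quasi-relative interior has to provide is that a continuous
affine function that attains its maximum over dom g at the given point is
constant on dom g ([qri_relint_point]): this is the property of a relative
interior point in finite dimension.  It passes from dom g to the cylinder over
dom g, on which G lives ([relint_point_cylinder]).

The multipliers are built one constraint at a time.  For a single constraint
l, the multiplier is minus a number which separates the values of F / l where
l < 0 from those where l > 0 ([crossing_slope]).  The
induction on the constraints distinguishes whether the last constraint l_j can
be satisfied strictly by a feasible point.  If it can, the relative interior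
point can be moved so that l_j < 0 there, and the constraint can be absorbed
into the domain.  If it cannot, then l_j is nonnegative under the other
constraints, so by induction l_j + sum_i mu_i l_i >= 0; this affine function
vanishes at the relative interior point, hence everywhere.  The constraint
l_j <= 0 may then be replaced by the equation l_j = 0, whose multiplier has an
unknown sign, and the sign is repaired by adding a large multiple of the
vanishing combination l_j + sum_i mu_i l_i. *)

Set Implicit Arguments.
Unset Strict Implicit.
Unset Printing Implicit Defensive.

Import Order.TTheory GRing.Theory Num.Theory.
Import numFieldNormedType.Exports.

Local Open Scope classical_set_scope.
Local Open Scope ring_scope.

(** * Convex functions under one affine constraint *)

Section affine_constraints.
Context {R : realType} {Z : lmodType R}.
Implicit Types (C : set Z) (F G l w : Z -> R) (W : set (Z -> R)).

Definition affine_fun w := forall (x y : Z) (t : R),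
  w (t *: x + (1 - t) *: y) = t * w x + (1 - t) * w y.

Definition convex_in C := forall (x y : Z) (t : R), C x -> C y -> 0 < t < 1 ->
  C (t *: x + (1 - t) *: y).

Definition convex_fun_on C F := forall (x y : Z) (t : R),
  C x -> C y -> 0 < t < 1 ->
  F (t *: x + (1 - t) *: y) <= t * F x + (1 - t) * F y.

(** W stands for the continuous affine functions; keeping it abstract separates
the convexity argument from the topology. *)
Definition affine_space W :=
  (forall w, W w -> affine_fun w) /\
  (forall w w' (c : R), W w -> W w' -> W (fun z => w z + c * w' z)).

(** In finite dimension, with W the affine functions, these are the points of the
relative interior of the convex set C: every hyperplane that supports C at such
a point contains C. *)
Definition relint_point W C (z0 : Z) := C z0 /\
  forall w, W w -> (forall z, C z -> w z <= w z0) ->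
  forall z, C z -> w z = w z0.

Lemma convex_in_setI C D : convex_in C -> convex_in D -> convex_in (C `&` D).
Proof. by move=> cC cD x y t [Cx Dx] [Cy Dy] t01; split; [exact: cC|exact: cD]. Qed.

Lemma affine_convex_le0 l : affine_fun l -> convex_in [set z | l z <= 0].
Proof. by move=> al x y t /= lx ly t01; rewrite al; nra. Qed.

Lemma affine_convex_eq0 l : affine_fun l -> convex_in [set z | l z = 0].
Proof. by move=> al x y t /= lx ly t01; rewrite al lx ly !mulr0 addr0. Qed.

Lemma convex_fun_onD_affine C F w (c : R) :
  convex_fun_on C F -> affine_fun w -> convex_fun_on C (fun z => F z + c * w z).
Proof.
move=> cF aw x y t Cx Cy t01; rewrite aw; have := cF x y t Cx Cy t01; lra.
Qed.

Lemma convex_fun_on_sub C D F : D `<=` C -> convex_fun_on C F ->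
  convex_fun_on D F.
Proof. by move=> DC cF x y t /DC Cx /DC Cy; exact: cF. Qed.

(** The segment from e to d crosses the hyperplane l = 0 at a point where F is
nonnegative, and convexity bounds F there by the chord. *)
Lemma crossing_slope C F l (d e : Z) : convex_in C -> convex_fun_on C F ->
  affine_fun l -> (forall z, C z -> l z = 0 -> 0 <= F z) ->
  C d -> C e -> l e < 0 -> 0 < l d -> F e / l e <= F d / l d.
Proof.
move=> cC cF al F0 Cd Ce le0 ld0.
(* the parameter at which the chord of l vanishes *)
pose t := - l e / (l d - l e).
have D0 : 0 < l d - l e by lra.
have t01 : 0 < t < 1.
  apply/andP; split; first by rewrite divr_gt0// oppr_gt0.
  by rewrite ltr_pdivrMr//; lra.
have E1 : t * (l d - l e) = - l e by rewrite /t divfK// gt_eqF.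
have lz : l (t *: d + (1 - t) *: e) = 0 by rewrite al; lra.
have := F0 _ (cC _ _ _ Cd Ce t01) lz.
move/le_trans/(_ (cF _ _ _ Cd Ce t01)) => H.
have {}H : 0 <= (t * F d + (1 - t) * F e) * (l d - l e).
  by rewrite mulr_ge0// ltW.
have {}H : 0 <= - l e * F d + l d * F e.
  suff -> : - l e * F d + l d * F e = (t * F d + (1 - t) * F e) * (l d - l e) by [].
  have -> : (t * F d + (1 - t) * F e) * (l d - l e) =
    (t * (l d - l e)) * F d + ((l d - l e) - t * (l d - l e)) * F e by ring.
  by rewrite E1; ring.
rewrite ler_pdivlMr// mulrAC ler_ndivrMr//; lra.
Qed.

(** By [crossing_slope] every quotient F / l taken where l < 0 lies below every
one taken where l > 0, so the supremum of the former separates the two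
families; its opposite is the multiplier. *)
Lemma multiplier_eq C F l : convex_in C -> convex_fun_on C F -> affine_fun l ->
  (exists2 z, C z & l z < 0) -> (exists2 z, C z & 0 < l z) ->
  (forall z, C z -> l z = 0 -> 0 <= F z) ->
  exists s : R, forall z, C z -> 0 <= F z + s * l z.
Proof.
move=> cC cF al [e0 Ce0 le0] [d0 Cd0 ld0] F0.
have slope := crossing_slope cC cF al F0.
pose S := [set F e / l e | e in [set z | C z /\ l z < 0]].
have S0 : S !=set0 by exists (F e0 / l e0), e0.
have ubS d : C d -> 0 < l d -> ubound S (F d / l d).
  by move=> Cd ld _ [e [Ce le] <-]; exact: slope.
have hS : has_ubound S by exists (F d0 / l d0); exact: ubS.
exists (- sup S) => z Cz.
have [lz|lz|lz] := ltrgtP (l z) 0; last by rewrite lz mulr0 addr0 F0.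
- have : F z / l z <= sup S by apply: ub_le_sup => //; exists z.
  by rewrite ler_ndivrMr//; lra.
- have : sup S <= F z / l z by apply: ge_sup => //; exact: ubS.
  by rewrite ler_pdivlMr//; lra.
Qed.

(** The multiplier of the equation l = 0 also serves the inequality: were it
negative, F would be nonnegative on the whole of C and 0 would do. *)
Lemma multiplier_le C F l : convex_in C -> convex_fun_on C F -> affine_fun l ->
  (exists2 z, C z & l z < 0) ->
  (forall z, C z -> l z <= 0 -> 0 <= F z) ->
  exists2 s : R, 0 <= s & forall z, C z -> 0 <= F z + s * l z.
Proof.
move=> cC cF al neg F0.
have [pos|npos] := pselect (exists2 z, C z & 0 < l z); last first.
  exists 0 => // z Cz; rewrite mul0r addr0 F0// leNgt.
  by apply/negP => lz; apply: npos; exists z.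
have [|s Hs] := multiplier_eq cC cF al neg pos.
  by move=> z Cz lz; apply: F0 => //; rewrite lz.
have [s0|s0] := leP 0 s; first by exists s.
exists 0 => // z Cz; rewrite mul0r addr0.
have [lz|lz] := leP (l z) 0; first exact: F0.
by have := Hs z Cz; nra.
Qed.

(** * Relative interior points of sections of a convex set *)

Section relint.
Context (W : set (Z -> R)) (affW : affine_space W).

(** At a relative interior point with l = 0, either l takes both signs on C or it
is identically zero there; in the latter case the constraint is void. *)
Lemma relint_multiplier_eq C F l z0 : convex_in C -> convex_fun_on C F ->
  W l -> relint_point W C z0 -> l z0 = 0 ->
  (forall z, C z -> l z = 0 -> 0 <= F z) ->
  exists s : R, forall z, C z -> 0 <= F z + s * l z.
Proof.
move=> cC cF Wl [Cz0 ri] lz0 F0; have [aW WD] := affW.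
have zero : (forall z, C z -> l z = 0) ->
    exists s : R, forall z, C z -> 0 <= F z + s * l z.
  by move=> l0; exists 0 => z Cz; rewrite mul0r addr0 F0// l0.
have [pos|npos] := pselect (exists2 z, C z & 0 < l z); last first.
  apply: zero => z Cz; rewrite -lz0; apply: ri => // y Cy.
  by rewrite lz0 leNgt; apply/negP => ly; apply: npos; exists y.
have [neg|nneg] := pselect (exists2 z, C z & l z < 0); last first.
  apply: zero => z Cz.
  (* l + (-2) l is the opposite of l, as an element of W *)
  have := ri _ (WD _ _ (- 2) Wl Wl) _ z Cz; rewrite lz0.
  suff H : forall y, C y -> l y + - 2 * l y <= 0 + - 2 * 0 by move=> /(_ H); lra.
  move=> y Cy; suff : 0 <= l y by lra.
  by rewrite leNgt; apply/negP => ly; apply: nneg; exists y.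
exact: multiplier_eq (aW _ Wl) neg pos F0.
Qed.

(** If w is maximal at z0 on the section l = 0, a multiplier s makes w - s l
maximal at z0 on the whole of C, so w - s l is constant on C. *)
Lemma relint_point_eq0 C l z0 : convex_in C -> W l -> relint_point W C z0 ->
  l z0 = 0 -> relint_point W (C `&` [set z | l z = 0]) z0.
Proof.
move=> cC Wl riC lz0; have [aW WD] := affW; have [Cz0 ri] := riC.
split=> // w Ww wle z [Cz lz].
have [||s Hs] := @relint_multiplier_eq C (fun z => w z0 - w z) l z0 cC _ Wl riC lz0.
- by move=> x y t _ _ _; rewrite (aW _ Ww); lra.
- by move=> y Cy ly; rewrite subr_ge0; apply: wle.
have := ri _ (WD _ _ (- s) Ww Wl) _ z Cz; rewrite lz lz0 !mulr0 !addr0; apply.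
by move=> y Cy; have := Hs y Cy; lra.
Qed.

(** A short enough piece of any segment from z0 into C stays in l <= 0, and an
affine function on a segment is determined by such a piece. *)
Lemma relint_point_lt0 C l z0 : convex_in C -> W l -> relint_point W C z0 ->
  l z0 < 0 -> relint_point W (C `&` [set z | l z <= 0]) z0.
Proof.
move=> cC Wl [Cz0 ri] lz0; have [aW WD] := affW.
split; first by split => //=; exact: ltW.
move=> w Ww wle z [Cz _]; apply: ri => // {Cz}z Cz.
(* small enough for t * l z + (1 - t) * l z0 <= 0, whatever the sign of l z *)
pose t := - l z0 / (`|l z| - l z0 + 1).
have D0 : 0 < `|l z| - l z0 + 1 by have := normr_ge0 (l z); lra.
have t01 : 0 < t < 1.
  apply/andP; split; first by rewrite divr_gt0// oppr_gt0.
  by rewrite ltr_pdivrMr//; have := normr_ge0 (l z); lra.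
have E1 : t * (`|l z| - l z0 + 1) = - l z0 by rewrite /t divfK// gt_eqF.
have := wle (t *: z + (1 - t) *: z0); rewrite (aW _ Ww).
have h : l (t *: z + (1 - t) *: z0) <= 0.
  by rewrite (aW _ Wl); have := ler_norm (l z); nra.
by move=> /(_ (conj (cC _ _ _ Cz Cz0 t01) h)); nra.
Qed.

(** An affine function that is maximal at the midpoint is maximal at both ends,
in particular at the relative interior point z0. *)
Lemma relint_point_mid C z0 z1 : convex_in C -> relint_point W C z0 -> C z1 ->
  relint_point W C (2^-1 *: z0 + (1 - 2^-1) *: z1).
Proof.
move=> cC [Cz0 ri] Cz1; have [aW _] := affW.
have h01 : 0 < (2^-1 : R) < 1 by lra.
split; first exact: cC.
move=> w Ww; rewrite (aW _ Ww) => wle z Cz.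
have := wle _ Cz0; have := wle _ Cz1 => w1 w0.
have w01 : w z1 = w z0.
  have := ri w Ww _ z1 Cz1; apply => y Cy.
  have := wle y Cy; lra.
have := ri w Ww _ z Cz; rewrite w01 => -> //; first lra.
by move=> y Cy; have := wle y Cy; lra.
Qed.

(** * Lagrange multipliers for finitely many affine constraints *)

Section combination.
Context {I : eqType} (l : I -> Z -> R).

Lemma affine_space_comb w (mu : I -> R) (r : seq I) :
  W w -> (forall i, i \in r -> W (l i)) ->
  W (fun z => w z + \sum_(i <- r) mu i * l i z).
Proof.
have [_ WD] := affW; elim: r w => [|j r IH] w Ww Wl.
  by under eq_fun do rewrite big_nil addr0.
under eq_fun do rewrite big_cons addrA.
apply: (IH (fun z => w z + mu j * l j z)); last first.
  by move=> i ir; apply: Wl; rewrite inE ir orbT.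
by apply: WD => //; apply: Wl; rewrite mem_head.
Qed.

Lemma convex_fun_on_comb C F (mu : I -> R) (r : seq I) :
  convex_fun_on C F -> (forall i, i \in r -> W (l i)) ->
  convex_fun_on C (fun z => F z + \sum_(i <- r) mu i * l i z).
Proof.
have [aW _] := affW; elim: r F => [|j r IH] F cF Wl.
  by under eq_fun do rewrite big_nil addr0.
under eq_fun do rewrite big_cons addrA.
apply: (IH (fun z => F z + mu j * l j z)); last first.
  by move=> i ir; apply: Wl; rewrite inE ir orbT.
by apply: convex_fun_onD_affine => //; apply/aW/Wl; rewrite mem_head.
Qed.

Lemma big_cons_update (j : I) (r : seq I) (s : R) (mu : I -> R) z :
  j \notin r ->
  \sum_(i <- j :: r) (if i == j then s else mu i) * l i z =
  s * l j z + \sum_(i <- r) mu i * l i z.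
Proof.
move=> jr; rewrite big_cons eqxx; congr (_ + _).
apply: eq_big_seq => i ir; case: eqP => // ij.
by move: jr; rewrite -ij ir.
Qed.

(** Slater's condition is relaxed here in the way that is specific to affine
constraints: the relative interior point may satisfy some of them with
equality. *)
Lemma lagrange_multipliers (r : seq I) C G z0 : uniq r ->
  (forall i, i \in r -> W (l i)) ->
  convex_in C -> convex_fun_on C G -> relint_point W C z0 ->
  (forall i, i \in r -> l i z0 <= 0) ->
  (forall z, C z -> (forall i, i \in r -> l i z <= 0) -> 0 <= G z) ->
  exists2 mu : I -> R, (forall i, 0 <= mu i) &
    forall z, C z -> 0 <= G z + \sum_(i <- r) mu i * l i z.
Proof.
have [aW WD] := affW.
elim: r C G z0 => [|j r IH] C G z0 /=.
  move=> _ _ _ _ _ _ G0; exists (fun=> 0) => // z Cz.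
  by rewrite big_nil addr0 G0.
move=> /andP[jr ur] Wl cC cG riC feas G0.
have Wr i : i \in r -> W (l i) by move=> ir; apply: Wl; rewrite inE ir orbT.
have Wj : W (l j) by apply: Wl; rewrite mem_head.
have consP z : l j z <= 0 -> (forall i, i \in r -> l i z <= 0) ->
    forall i, i \in j :: r -> l i z <= 0.
  by move=> lj lr i; rewrite inE => /predU1P[->|/lr].
have feasr z : (forall i, i \in j :: r -> l i z <= 0) ->
    forall i, i \in r -> l i z <= 0.
  by move=> lr i ir; apply: lr; rewrite inE ir orbT.
have [[z1 Cz1 [lz1 lj1]]|tight] := pselect (exists2 z, C z &
    (forall i, i \in j :: r -> l i z <= 0) /\ l j z < 0).
(* Some feasible point has l j < 0; so does its midpoint with z0, which inherits
   the relative interior property. *)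
- pose z2 := 2^-1 *: z0 + (1 - 2^-1) *: z1.
  have ri2 : relint_point W C z2 by exact: relint_point_mid.
  have feas2 i : i \in j :: r -> l i z2 <= 0.
    move=> ir; rewrite (aW _ (Wl _ ir)).
    by have := feas _ ir; have := lz1 _ ir; lra.
  have lj2 : l j z2 < 0.
    rewrite (aW _ Wj); have := feas j (mem_head _ _); lra.
  have [|||||nu nu0 Hnu] := IH (C `&` [set z | l j z <= 0]) G z2 ur Wr.
  + by apply: convex_in_setI => //; apply: affine_convex_le0; exact: aW.
  + by apply: convex_fun_on_sub cG => z [].
  + exact: relint_point_lt0.
  + exact: feasr.
  + by move=> z [Cz ljz] lz; apply: G0 => //; exact: consP.
  have [||s s0 Hs] := multiplier_le cC (convex_fun_on_comb nu cG Wr) (aW _ Wj).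
  + by exists z1.
  + by move=> z Cz ljz; apply: Hnu.
  exists (fun i => if i == j then s else nu i) => [i|z Cz]; first by case: eqP.
  by rewrite big_cons_update//; have := Hs z Cz; lra.
(* No feasible point has l j < 0, so l j >= 0 where the other constraints hold,
   and the induction hypothesis applies to l j as objective. *)
- have lj0 : l j z0 = 0.
    apply/eqP; rewrite eq_le (feas j) ?mem_head//= leNgt; apply/negP => lj0.
    by apply: tight; exists z0 => //; exact: riC.1.
  have [|||mu mu0 Hmu] := IH C (l j) z0 ur Wr cC _ riC.
  + by move=> x y t _ _ _; rewrite (aW _ Wj).
  + exact: feasr.
  + move=> z Cz lz; rewrite leNgt; apply/negP => ljz; apply: tight.
    by exists z => //; split => //; apply: consP => //; exact: ltW.
  have mu_eq0 z : C z -> l j z + \sum_(i <- r) mu i * l i z = 0.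
    have lr0 : \sum_(i <- r) mu i * l i z0 <= 0.
      rewrite big_seq; apply: sumr_le0 => i ir.
      by rewrite mulr_ge0_le0//; apply: feasr ir.
    have e0 : \sum_(i <- r) mu i * l i z0 = 0.
      by have := Hmu _ riC.1; lra.
    (* the combination is minimal at z0, its opposite c + (-2) c is maximal *)
    have Wm := affine_space_comb mu Wj Wr.
    move=> Cz; have := riC.2 _ (WD _ _ (- 2) Wm Wm) _ z Cz.
    rewrite lj0 e0.
    suff H : forall y, C y -> (l j y + \sum_(i <- r) mu i * l i y) +
        - 2 * (l j y + \sum_(i <- r) mu i * l i y) <= 0 + 0 + - 2 * (0 + 0).
      by move=> /(_ H); lra.
    by move=> y Cy; have := Hmu y Cy; lra.
  have [|||||nu nu0 Hnu] := IH (C `&` [set z | l j z = 0]) G z0 ur Wr.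
  + by apply: convex_in_setI => //; apply: affine_convex_eq0; exact: aW.
  + by apply: convex_fun_on_sub cG => z [].
  + exact: relint_point_eq0.
  + exact: feasr.
  + by move=> z [Cz ljz] lz; apply: G0 => //; apply: consP => //; rewrite ljz.
  have [|s Hs] := relint_multiplier_eq cC (convex_fun_on_comb nu cG Wr) Wj riC lj0.
    by move=> z Cz ljz; apply: Hnu.
  (* s may be negative: `|s| times the combination that vanishes on C is added *)
  exists (fun i => if i == j then s + `|s| else nu i + `|s| * mu i).
    move=> i; case: eqP => _; last by rewrite addr_ge0// mulr_ge0.
    by have := ler_norm (- s); rewrite normrN; lra.
  move=> z Cz; rewrite big_cons_update//.
  under eq_bigr do rewrite mulrDl -mulrA.
  rewrite big_split -mulr_sumr/=.
  by have := Hs z Cz; have := mu_eq0 z Cz; nra.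
Qed.

End combination.
End relint.
End affine_constraints.

(** * Quasi-relative interior points and continuous affine functions *)

Section continuous_affine.
Context {R : realType}.

Definition continuous_affine (Z : tvsType R) : set (Z -> R) :=
  [set w | affine_fun w /\ continuous (w : Z -> R^o)].

Arguments continuous_affine Z : clear implicits.

Lemma affine_space_continuous_affine (Z : tvsType R) :
  affine_space (continuous_affine Z).
Proof.
split=> [w []//|w w' c [aw cw] [aw' cw']]; split.
  by move=> x y t; rewrite aw aw'; ring.
move=> x; apply: (@cvgD _ R^o); first exact: cw.
by apply: (@cvgMr R); exact: cw'.
Qed.

Lemma linear_continuous_affine (Z : tvsType R) (u : {linear Z -> R^o}) (d : R) :
  top_dual u -> continuous_affine Z (fun z => u z - d).
Proof.
move=> cu; split; first by move=> x y t; rewrite linearD !linearZ/= /GRing.scale/=; ring.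
by move=> x; apply: (@cvgB _ R^o); [exact: cu|exact: cvg_cst].
Qed.

(** If w is maximal at x0, the closed set of the z with w (x0 + z) <= w x0
contains the closure of cone (Omega - x0).  That closure is a subspace, so
along with y - x0 it contains x0 - y, where w takes the value 2 w x0 - w y. *)
Lemma qri_relint_point (X : tvsType R) (Omega : set X) (x0 : X) :
  qri Omega x0 -> relint_point (continuous_affine X) Omega x0.
Proof.
move=> [Ox0 [_ lin]]; split=> // w [aw cw] wle y Oy.
have shift t y' : w (t *: (y' - x0) + x0) = t * w y' + (1 - t) * w x0.
  by rewrite -aw scalerBr scalerBl scale1r -addrA (addrC (- _)).
pose D := [set z | w (z + x0) <= w x0].
have clD : closed D.
  apply: (@closed_comp _ R^o (fun z => w (z + x0)) [set r | r <= w x0]).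
    move=> z _; apply: (@continuous_comp _ _ _ (fun z => z + x0) w); last exact: cw.
    apply: (@continuous2_cvg _ _ _ _ _ _ id (cst x0) +%R).
    - exact: (add_continuous (z, x0)).
    - exact: cvg_id.
    - exact: cvg_cst.
  exact: closed_le.
have coneD : cone [set y - x0 | y in Omega] `<=` D.
  move=> _ [t [_ [y' Oy' <-] [t0 ->]]]; rewrite /D/=.
  by rewrite shift; have := wle _ Oy'; nra.
have subD : closure (cone [set y - x0 | y in Omega]) `<=` D.
  by rewrite ((closure_id D).1 clD); exact: closure_subset.
have mem0 : 0 \in mem (closure (cone [set y - x0 | y in Omega])).
  apply/mem_set/subset_closure; exists 0; exists 0; last by rewrite scale0r.
  by exists x0 => //; rewrite subrr.
have memy : y - x0 \in mem (closure (cone [set y - x0 | y in Omega])).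
  apply/mem_set/subset_closure; exists 1; exists (y - x0); first by exists y.
  by rewrite scale1r.
have /set_mem/subD := lin (-1) _ _ memy mem0.
rewrite /D/= addr0 shift => h; apply/eqP; rewrite eq_le wle//=; lra.
Qed.

Lemma continuous_affine_slice (X : tvsType R) (w : (X * R^o)%type -> R)
    (s0 : R) : continuous_affine (X * R^o)%type w ->
  continuous_affine X (fun x => w (x, s0)).
Proof.
move=> [aw cw]; split.
  move=> x x' t; rewrite -aw; congr w; congr pair.
  by rewrite -scalerDl addrC subrK scale1r.
have pair_cont : continuous (fun x : X => (x, s0) : (X * R^o)%type).
  move=> x; apply: (@cvg_pair _ _ _ (nbhs x) (nbhs x) (nbhs (s0 : R^o))).
  - exact: cvg_id.
  - exact: (@cvg_cst R^o).
by move=> x; apply: continuous_comp; [exact: pair_cont|exact: cw].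
Qed.

(** An affine function that is bounded above on the cylinder over C is constant
along each vertical line, so it is determined by its slice at height s0. *)
Lemma relint_point_cylinder (X : tvsType R) (C : set X) (x0 : X) (s0 : R) :
  relint_point (continuous_affine X) C x0 ->
  relint_point (continuous_affine (X * R^o)%type)
    [set p | C p.1] (x0, s0).
Proof.
move=> [Cx0 ri]; split=> // w [aw cw] wle [y s] /= Cy.
have const x : C x -> w (x, s) = w (x, s0).
  move=> Cx; apply/eqP; apply: contraT => ne.
  (* the point of the vertical line where w would exceed its bound w (x0, s0) by 1 *)
  pose t := (w (x0, s0) + 1 - w (x, s0)) / (w (x, s) - w (x, s0)).
  pose p : (X * R^o)%type := (x, s); pose p0 : (X * R^o)%type := (x, s0).
  have : w (t *: p + (1 - t) *: p0) <= w (x0, s0).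
    by apply: wle; rewrite /= -scalerDl addrC subrK scale1r.
  rewrite aw; have : t * (w (x, s) - w (x, s0)) = w (x0, s0) + 1 - w (x, s0).
    by rewrite /t divfK// subr_eq0.
  lra.
rewrite (const _ Cy).
have slice := continuous_affine_slice s0 (conj aw cw).
by apply: (ri _ slice) => // x Cx; exact: wle.
Qed.

End continuous_affine.

Arguments continuous_affine {R} Z.

(** * Fenchel duality *)

Section duality.
Context {R : realType} {X : tvsType R}.
Implicit Types f g : X -> \bar R.

Lemma convex_in_edom g : (forall x, (-oo < g x)%E) -> convex_efun g ->
  convex_in (edom g).
Proof.
move=> gNy cg x y t gx gy t01; apply: le_lt_trans (cg x y t t01) _.
have fin z : edom g z -> g z \is a fin_num by rewrite fin_numElt gNy.
by rewrite -(fineK (fin _ gx)) -(fineK (fin _ gy)) -!EFinM -EFinD ltry.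
Qed.

Lemma convex_fun_on_fine g : (forall x, (-oo < g x)%E) -> convex_efun g ->
  convex_fun_on (edom g) (fine \o g).
Proof.
move=> gNy cg x y t gx gy t01.
have fin z : edom g z -> g z \is a fin_num by rewrite fin_numElt gNy.
have gxy := convex_in_edom gNy cg gx gy t01.
rewrite -lee_fin /= EFinD !EFinM !fineK; do ?exact: fin.
exact: cg.
Qed.

Lemma weak_duality f g (u : {linear X -> R^o}) :
  (forall x, (-oo < f x)%E) -> (forall x, (-oo < g x)%E) ->
  (- fenchel_conj f (\- u)%R - fenchel_conj g u <=
   ereal_inf [set (f x + g x)%E | x in [set: X]])%E.
Proof.
move=> fNy gNy; apply/ereal_infP => _ [x _ <-].
have [->|fx] := eqVneq (f x) +oo%E; first by rewrite addye ?leey// gt_eqF.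
have [->|gx] := eqVneq (g x) +oo%E; first by rewrite addey ?leey// gt_eqF.
have ffin : f x \is a fin_num by rewrite fin_numElt fNy lt_neqAle fx leey.
have gfin : g x \is a fin_num by rewrite fin_numElt gNy lt_neqAle gx leey.
have fle : (- fenchel_conj f (\- u)%R <= (u x)%:E + f x)%E.
  rewrite leeNl oppeD ?fin_num_adde_defr// -EFinN.
  by apply: ereal_sup_ubound; exists x.
have gle : (- fenchel_conj g u <= g x - (u x)%:E)%E.
  rewrite leeNl oppeB ?fin_num_adde_defr// addeC.
  by apply: ereal_sup_ubound; exists x.
apply: le_trans (leeD fle gle) _.
rewrite -(fineK ffin) -(fineK gfin) -EFinN -!EFinD lee_fin; lra.
Qed.

Lemma dual_form_of_multipliers (k : nat)
    (z : 'I_k -> {linear (X * R^o)%type -> R^o}) (mu : 'I_k -> R) :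
  (forall i, top_dual (z i)) ->
  exists2 u : {linear X -> R^o}, top_dual u &
    forall x, u x = - \sum_i mu i * z i (x, 0).
Proof.
move=> cz.
pose v (x : X) : R^o := - \sum_i mu i * z i (x, 0).
have vlin : linear v.
  move=> a x y; rewrite /v /GRing.scale/= mulrN mulr_sumr -opprD -big_split/=.
  congr (- _); apply: eq_bigr => i _.
  have -> : (a *: x + y, 0) = a *: (x, 0) + (y, 0) :> (X * R^o)%type.
    by congr pair; rewrite /= scaler0 addr0.
  by rewrite linearD linearZ /= /GRing.scale/=; ring.
have slice i : continuous_affine X (fun x => z i (x, 0)).
  have := continuous_affine_slice 0 (linear_continuous_affine 0 (cz i)).
  by under eq_fun do rewrite subr0.
have zeroW : continuous_affine X (fun=> 0).
  split; first by move=> x y t; rewrite !mulr0 addr0.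
  by move=> x; exact: (@cvg_cst R^o).
have [_ vcont] := affine_space_comb (affine_space_continuous_affine X)
  (fun i => - mu i) (r := index_enum 'I_k) zeroW (fun i _ => slice i).
have vE : v = (fun x => 0 + \sum_(i <- index_enum 'I_k) - mu i * z i (x, 0)).
  apply/funext => x; rewrite add0r /v -sumrN.
  by apply: eq_bigr => i _; rewrite mulNr.
rewrite -vE in vcont.
pose vL : {linear X -> R^o} :=
  HB.pack v (GRing.isLinear.Build R X R^o *:%R v vlin).
by exists vL.
Qed.


(** The multipliers of the constraints z i <= a i that describe epi f, applied
to the objective g y + s - r, give a dual solution u. *)
Lemma dual_attains_lower_bound f g (r : R) :
  (forall x, (-oo < f x)%E) -> (forall x, (-oo < g x)%E) ->
  convex_efun g -> polyhedral f -> edom f `&` qri (edom g) !=set0 ->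
  (forall x, (r%:E <= f x + g x)%E) ->
  exists2 u : {linear X -> R^o}, top_dual u &
    (r%:E <= - fenchel_conj f (\- u)%R - fenchel_conj g u)%E.
Proof.
move=> fNy gNy cg [k [z [a [cz epiE]]]] [x0 [fx0 qx0]] r_le.
have epiP p : epi f p <-> forall i, z i p <= a i by rewrite epiE.
have ffin x : edom f x -> f x \is a fin_num by rewrite fin_numElt fNy.
have gfin x : edom g x -> g x \is a fin_num by rewrite fin_numElt gNy.
pose l (i : 'I_k) (p : (X * R^o)%type) : R := z i p - a i.
pose C : set (X * R^o)%type := [set p | edom g p.1].
pose G (p : (X * R^o)%type) : R := fine (g p.1) + p.2 - r.
have Wl i : continuous_affine (X * R^o)%type (l i).
  exact: linear_continuous_affine.
have cC : convex_in C.
  by move=> p q t Cp Cq t01; exact: (convex_in_edom gNy cg).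
have cG : convex_fun_on C G.
  move=> p q t Cp Cq t01; have := convex_fun_on_fine gNy cg Cp Cq t01.
  by rewrite /G/= /GRing.scale/=; lra.
have riC := relint_point_cylinder (fine (f x0)) (qri_relint_point qx0).
have [||mu mu0 Hmu] := lagrange_multipliers
  (affine_space_continuous_affine (X * R^o)%type) (index_enum_uniq _)
  (fun i _ => Wl i) cC cG riC.
- move=> i _; rewrite subr_le0; apply: (epiP _).1 => /=.
  by rewrite /epi/= fineK// ffin.
- move=> [y s] Cy feas; have /epiP : forall i, z i (y, s) <= a i.
    by move=> i; rewrite -subr_le0; apply: feas; exact: mem_index_enum.
  rewrite /epi/= => fys; rewrite /G/= subr_ge0 -lee_fin EFinD fineK ?gfin//.
  by rewrite (le_trans (r_le y))// addeC leeD2r.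
have [u cu uE] := dual_form_of_multipliers mu cz.
pose c := \sum_i mu i * z i (0, 1).
pose b := \sum_i mu i * a i.
have sumE x s : \sum_i mu i * z i (x, s) = s * c - u x.
  rewrite uE opprK /c mulr_sumr -big_split/=; apply: eq_bigr => i _.
  have -> : (x, s) = s *: (0, 1) + (x, 0) :> (X * R^o)%type.
    by congr pair; rewrite /= ?scaler0 ?add0r// /GRing.scale/= mulr1 addr0.
  by rewrite linearD linearZ /= /GRing.scale/=; ring.
have lagr y s : edom g y -> 0 <= fine (g y) + s - r + (s * c - u y - b).
  move=> gy; have := Hmu (y, s) gy; rewrite /G/= -sumE /b -sumrB.
  by under eq_bigr do rewrite mulrBr.
have gx0 : edom g x0 by exact: qx0.1.
(* Otherwise the choice of s below makes the affine function of s in lagr, taken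
   at y = x0, equal to -1. *)
have c1 : c = -1.
  apply/eqP; rewrite -subr_eq0 opprK; apply: contraT => c0.
  pose m := fine (g x0) - r - u x0 - b.
  have := lagr x0 (- (m + 1) / (c + 1)) gx0.
  have : (- (m + 1) / (c + 1)) * (c + 1) = - (m + 1) by rewrite divfK.
  by rewrite /m; lra.
have fle : (fenchel_conj f (\- u)%R <= b%:E)%E.
  apply: ge_ereal_sup => _ [x _ <-] /=.
  have [fx|fx] := pselect (edom f x); last first.
    by move/negP: fx; rewrite /edom/= ltNge negbK leye_eq => /eqP ->; rewrite leNye.
  rewrite -(fineK (ffin _ fx)) -EFinN -EFinD lee_fin.
  have : \sum_i mu i * z i (x, fine (f x)) <= b.
    apply: ler_sum => i _; apply: ler_wpM2l => //.
    by apply: (epiP _).1; rewrite /epi/= fineK// ffin.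
  by rewrite sumE c1; lra.
have gle : (fenchel_conj g u <= (- r - b)%:E)%E.
  apply: ge_ereal_sup => _ [y _ <-] /=.
  have [gy|gy] := pselect (edom g y); last first.
    by move/negP: gy; rewrite /edom/= ltNge negbK leye_eq => /eqP ->; rewrite leNye.
  rewrite -(fineK (gfin _ gy)) -EFinN -EFinD lee_fin.
  by have := lagr y 0 gy; lra.
exists u => //; apply: (@le_trans _ _ (- b%:E - (- r - b)%:E)%E).
  by rewrite -!EFinN -EFinD lee_fin; lra.
by apply: leeD; rewrite leeN2.
Qed.

End duality.

Theorem theorem6p4 (R : realType) (X : tvsType R) (f g : X -> \bar R)
    (f_gtNy : forall x, (-oo < f x)%E) (g_gtNy : forall x, (-oo < g x)%E)
    (f_convex : convex_efun f) (g_convex : convex_efun g)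
    (f_polyhedral : polyhedral f)
    (f_qri_g : edom f `&` qri (edom g) !=set0) :
  ereal_inf [set (f x + g x)%E | x in [set: X]] =
  ereal_sup [set (- fenchel_conj f (\- u)%R - fenchel_conj g u)%E
            | u in top_dual].
Proof.
apply/eqP; rewrite eq_le; apply/andP; split; last first.
  by apply/ereal_supP => _ [u _ <-]; exact: weak_duality.
have inf_le x : (ereal_inf [set (f x + g x)%E | x in [set: X]] <= f x + g x)%E.
  by apply: ereal_inf_lbound; exists x.
move: inf_le; case: (ereal_inf _) => [r| |] inf_le; last by rewrite leNye.
- have [u cu ru] := dual_attains_lower_bound f_gtNy g_gtNy g_convex f_polyhedral f_qri_g inf_le.
  by apply: le_trans ru _; apply: ereal_sup_ubound; exists u.
- have [x0 [fx0 [gx0 _]]] := f_qri_g.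
  by have := inf_le x0; rewrite leye_eq => /eqP h; have := lte_add_pinfty fx0 gx0; rewrite h.
Qed.
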